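(* Let $\mathcal C$ be a semi-$\mathcal Z$-prenormal category. Let $\mathcal F$ be a $\mathcal Z$-normal-epi-reflective (full, replete) subcategory of $\mathcal C$, with reflector $F\colon\mathcal C\to\mathcal F$ and unit $\varphi$, with components $\varphi_X\colon X\to FX$. Then the following are equivalent. (i) $\mathcal F$ is a $\mathcal Z$-torsion-free subcategory of $\mathcal C$. (ii) The units of the reflection are stable under pullbacks along $\mathcal Z$-normal monomorphisms, meaning that for any pullback square $$\begin{array}{ccc} P & \xrightarrow{f'} & Y\\ {\scriptstyle p}\downarrow & & \downarrow{\scriptstyle \varphi_Y}\\ X & \xrightarrow{f} & FY\end{array}$$ with $f$ a $\mathcal Z$-normal monomorphism, $(X,p)$ is an $\mathcal F$-reflection of $P$ (that is, $X\in\mathcal F$ and every morphism from $P$ to an object of $\mathcal F$ factors uniquely through $p$).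
   Context: Let $\mathcal C$ be a category and $\mathcal Z$ a full replete subcategory (the trivial objects). A morphism of $\mathcal C$ is $\mathcal Z$-trivial if it factors through an object of $\mathcal Z$. A $\mathcal Z$-kernel of $f\colon A\to B$ is a pair $(K,k\colon K\to A)$ such that $f\circ k$ is $\mathcal Z$-trivial and every $x\colon X\to A$ with $f\circ x$ $\mathcal Z$-trivial factors uniquely as $x=k\circ x'$. A $\mathcal Z$-cokernel is defined dually. A $\mathcal Z$-normal monomorphism (resp. $\mathcal Z$-normal epimorphism) is a morphism that is a $\mathcal Z$-kernel (resp. $\mathcal Z$-cokernel) of some morphism. A sequence $A\xrightarrow{f}B\xrightarrow{g}C$ is $\mathcal Z$-exact if $(A,f)$ is the $\mathcal Z$-kernel of $g$ and $(C,g)$ is the $\mathcal Z$-cokernel of $f$. $\mathcal C$ is semi-$\mathcal Z$-prenormal if $\mathcal Z$ is mono-coreflective in $\mathcal C$ (the inclusion has a right adjoint and the counit components are monomorphisms) and: (1) $\mathcal C$ has pullbacks along $\mathcal Z$-normal monomorphisms; (2) $\mathcal C$ has $\mathcal Z$-cokernels of $\mathcal Z$-kernels; (3) the pullback of a $\mathcal Z$-normal epimorphism along a $\mathcal Z$-normal monomorphism is a $\mathcal Z$-normal epimorphism. A $\mathcal Z$-torsion theory on $\mathcal C$ is a pair $(\mathcal T,\mathcal F)$ of full replete subcategories such that every morphism $A\to B$ with $A\in\mathcal T$, $B\in\mathcal F$ is $\mathcal Z$-trivial, and for every object $X$ there is a $\mathcal Z$-exact sequence $A\to X\to B$ with $A\in\mathcal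 T$ and $B\in\mathcal F$. A subcategory $\mathcal F$ is $\mathcal Z$-torsion-free if there is a $\mathcal T$ such that $(\mathcal T,\mathcal F)$ is a $\mathcal Z$-torsion theory. A full replete subcategory $\mathcal F$ is $\mathcal Z$-normal-epi-reflective if the inclusion $\mathcal F\hookrightarrow\mathcal C$ has a left adjoint and the components of the unit are $\mathcal Z$-normal epimorphisms. *)

(* Defs.v *)
Set Implicit Arguments.
Unset Strict Implicit.
Unset Printing Implicit Defensive.

Declare Scope cat_scope.
Delimit Scope cat_scope with cat.
Local Open Scope cat_scope.

(** * Categories, functors, adjunctions *)

(* Equality of morphisms is Leibniz equality. *)
Record category := Category {
  obj :> Type;
  hom : obj -> obj -> Type;
  idm : forall A, hom A A;
  comp : forall A B C, hom B C -> hom A B -> hom A C;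
  comp_assoc : forall A B C D (h : hom C D) (g : hom B C) (f : hom A B),
    comp h (comp g f) = comp (comp h g) f;
  comp_idl : forall A B (f : hom A B), comp (idm B) f = f;
  comp_idr : forall A B (f : hom A B), comp f (idm A) = f }.

Arguments hom {c} A B.
Arguments idm {c} A.

Notation "A ~> B" := (hom A B) (at level 90, no associativity) : cat_scope.
Notation "g '\o' f" := (comp g f) (at level 40, left associativity) : cat_scope.

Record functor (C D : category) := Functor {
  fobj :> obj C -> obj D;
  fmap : forall A B : C, (A ~> B) -> (fobj A ~> fobj B);
  fmap_id : forall A : C, fmap (idm A) = idm (fobj A);
  fmap_comp : forall (A B E : C) (g : B ~> E) (f : A ~> B),
    fmap (g \o f) = fmap g \o fmap f }.

Definition functor_id (C : category) : functor C C :=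
  {| fobj := fun A => A;
     fmap := fun A B f => f;
     fmap_id := fun A => eq_refl;
     fmap_comp := fun A B E g f => eq_refl |}.

Definition functor_comp (C D E : category) (G : functor D E) (F : functor C D) :
  functor C E :=
  {| fobj := fun A => G (F A);
     fmap := fun A B f => fmap G (fmap F f);
     fmap_id := fun A => eq_trans (f_equal _ (fmap_id F A)) (fmap_id G (F A));
     fmap_comp := fun A B X g f =>
       eq_trans (f_equal _ (fmap_comp F g f)) (fmap_comp G (fmap F g) (fmap F f)) |}.

Record nat_trans (C D : category) (F G : functor C D) := NatTrans {
  component :> forall A : C, F A ~> G A;
  naturality : forall (A B : C) (f : A ~> B),
    component B \o fmap F f = fmap G f \o component A }.

(* [adjunction L R]: L is left adjoint to R. *)
Record adjunction (C D : category) (L : functor C D) (R : functor D C) := Adjunction {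
  adj_unit : nat_trans (functor_id C) (functor_comp R L);
  adj_counit : nat_trans (functor_comp L R) (functor_id D);
  triangle_left : forall A : C,
    adj_counit (L A) \o fmap L (adj_unit A) = idm (L A);
  triangle_right : forall B : D,
    fmap R (adj_counit B) \o adj_unit (R B) = idm (R B) }.

(** * Monomorphisms, isomorphic objects, pullbacks *)

Definition is_mono (C : category) (A B : C) (m : A ~> B) : Prop :=
  forall (X : C) (x y : X ~> A), m \o x = m \o y -> x = y.

Definition isomorphic (C : category) (A B : C) : Prop :=
  exists (f : A ~> B) (g : B ~> A), g \o f = idm A /\ f \o g = idm B.

(* The square with sides f : X -> B, g : Y -> B and projections
   p : P -> X, q : P -> Y is a pullback. *)
Definition is_pullback (C : category) (P X Y B : C)
    (p : P ~> X) (q : P ~> Y) (f : X ~> B) (g : Y ~> B) : Prop :=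
  f \o p = g \o q /\
  forall (U : C) (u : U ~> X) (v : U ~> Y), f \o u = g \o v ->
    exists! w : U ~> P, p \o w = u /\ q \o w = v.

(** * Full replete subcategories *)

(* A full subcategory is determined by its class of objects. *)
Record full_replete (C : category) := FullReplete {
  mem :> obj C -> Prop;
  replete : forall A B : C, isomorphic A B -> mem A -> mem B }.

Definition full_sub (C : category) (S : full_replete C) : category :=
  {| obj := {A : C | S A};
     hom := fun A B => proj1_sig A ~> proj1_sig B;
     idm := fun A => idm (proj1_sig A);
     comp := fun A B E g f => g \o f;
     comp_assoc := fun A B E X h g f => comp_assoc h g f;
     comp_idl := fun A B f => comp_idl f;
     comp_idr := fun A B f => comp_idr f |}.

Definition inclusion (C : category) (S : full_replete C) : functor (full_sub S) C :=
  {| fobj := fun A : full_sub S => proj1_sig A;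
     fmap := fun (A B : full_sub S) (f : A ~> B) => f;
     fmap_id := fun A => eq_refl;
     fmap_comp := fun A B E g f => eq_refl |}.

Definition mono_coreflective (C : category) (S : full_replete C) : Prop :=
  exists (R : functor C (full_sub S)) (adj : adjunction (inclusion S) R),
    forall X : C, is_mono (adj_counit adj X).

(* [(A, p)] is a reflection of [P] in the full subcategory [S]. *)
Definition is_reflection (C : category) (S : full_replete C) (P A : C)
    (p : P ~> A) : Prop :=
  S A /\
  forall (B : C) (h : P ~> B), S B -> exists! h' : A ~> B, h = h' \o p.

(** * Kernels, cokernels and exactness relative to trivial objects *)

Definition is_trivial (C : category) (Z : full_replete C) (A B : C)
    (f : A ~> B) : Prop :=
  exists (W : C) (v : W ~> B) (u : A ~> W), Z W /\ f = v \o u.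

Definition is_kernel (C : category) (Z : full_replete C) (A B K : C)
    (f : A ~> B) (k : K ~> A) : Prop :=
  is_trivial Z (f \o k) /\
  forall (X : C) (x : X ~> A), is_trivial Z (f \o x) ->
    exists! x' : X ~> K, x = k \o x'.

Definition is_cokernel (C : category) (Z : full_replete C) (A B Q : C)
    (f : A ~> B) (q : B ~> Q) : Prop :=
  is_trivial Z (q \o f) /\
  forall (X : C) (x : B ~> X), is_trivial Z (x \o f) ->
    exists! x' : Q ~> X, x = x' \o q.

Definition normal_mono (C : category) (Z : full_replete C) (K A : C)
    (k : K ~> A) : Prop :=
  exists (B : C) (f : A ~> B), is_kernel Z f k.

Definition normal_epi (C : category) (Z : full_replete C) (B Q : C)
    (q : B ~> Q) : Prop :=
  exists (A : C) (f : A ~> B), is_cokernel Z f q.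

Definition is_exact (C : category) (Z : full_replete C) (A B E : C)
    (f : A ~> B) (g : B ~> E) : Prop :=
  is_kernel Z g f /\ is_cokernel Z f g.

Record semi_prenormal (C : category) (Z : full_replete C) : Prop := SemiPrenormal {
  trivial_mono_coreflective : mono_coreflective Z;
  pullbacks_along_normal_mono :
    forall (X Y B : C) (f : X ~> B) (g : Y ~> B), normal_mono Z f ->
      exists (P : C) (p : P ~> X) (q : P ~> Y), is_pullback p q f g;
  cokernels_of_kernels :
    forall (K A B : C) (f : A ~> B) (k : K ~> A), is_kernel Z f k ->
      exists (Q : C) (q : A ~> Q), is_cokernel Z k q;
  normal_epi_pullback_stable :
    forall (P X Y B : C) (p : P ~> X) (q : P ~> Y) (f : X ~> B) (g : Y ~> B),
      is_pullback p q f g -> normal_mono Z f -> normal_epi Z g ->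
      normal_epi Z p }.

(** * Torsion theories *)

Record torsion_theory (C : category) (Z T F : full_replete C) : Prop := TorsionTheory {
  torsion_hom_trivial :
    forall (A B : C) (f : A ~> B), T A -> F B -> is_trivial Z f;
  torsion_exact_sequence :
    forall X : C, exists (A B : C) (f : A ~> X) (g : X ~> B),
      T A /\ F B /\ is_exact Z f g }.

Definition torsion_free (C : category) (Z F : full_replete C) : Prop :=
  exists T : full_replete C, torsion_theory Z T F.

(* Main.v *)
Require Import Defs.
Set Implicit Arguments.
Unset Strict Implicit.
Local Open Scope cat_scope.

(** Write [zeta_B : ZB -> B] for the counit of the coreflection onto the trivial
    objects and [phi_X : X -> FX] for the unit of the reflection onto [F].  A
    morphism into [B] is trivial exactly when it factors through [zeta_B], so
    [zeta_B] is the kernel of [idm B]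
    ([identity_kernel_of_mono_coreflective]).  It is therefore a normal
    monomorphism, its pullback along any [f : A -> B] exists, and that pullback is
    the kernel of [f] ([pullback_of_kernel]).  Moreover a normal epimorphism is the
    cokernel of its kernel ([normal_epi_cokernel_of_kernel]).

    If [(T, F)] is a torsion theory, its exact sequence on [Y] begins with a
    morphism [t] from a torsion object which is also a kernel of [phi_Y].  Given
    the pullback [p] of [phi_Y] along a normal monomorphism [f], the morphism [t]
    lifts to a kernel of [p] with the same domain ([kernel_lifts_to_pullback]).
    As [p] is a normal epimorphism by prenormality, it is the cokernel of a
    morphism out of a torsion object, and morphisms from the latter to [F] are
    trivial: this is the universal property of a reflection.  The codomain of [p]
    lies in [F] because [F] is closed under normal subobjects
    ([normal_subobject_in_reflective]).

    Conversely, let [T] consist of the objects all of whose morphisms into [F] are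
    trivial.  The kernel [t : K -> X] of [phi_X] is the pullback of [zeta_FX], and
    stability applied to this very square says that [K -> Z(FX)] is a reflection
    of [K].  Hence all morphisms from [K] to [F] factor through the trivial object
    [Z(FX)], that is, [K] is in [T], and [(t, phi_X)] is the required exact
    sequence. *)

(** * Universal property of units and counits *)

Lemma adj_unit_factor (C D : category) (L : functor C D) (R : functor D C)
    (adj : adjunction L R) (X : C) (B : D) (h : X ~> R B) :
  exists h' : L X ~> B, h = fmap R h' \o adj_unit adj X.
Proof.
  exists (adj_counit adj B \o fmap L h).
  rewrite fmap_comp, <- comp_assoc; symmetry.
  etransitivity;
    [exact (f_equal (comp _) (eq_sym (naturality (adj_unit adj) h))) |].
  etransitivity; [apply comp_assoc |].
  etransitivity;
    [exact (f_equal (fun e => e \o h) (triangle_right adj B)) | apply comp_idl].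
Qed.

Lemma adj_counit_factor (C D : category) (L : functor C D) (R : functor D C)
    (adj : adjunction L R) (W : C) (B : D) (h : L W ~> B) :
  exists h' : W ~> R B, h = adj_counit adj B \o fmap L h'.
Proof.
  exists (fmap R h \o adj_unit adj W).
  rewrite fmap_comp, comp_assoc; symmetry.
  etransitivity;
    [exact (f_equal (fun e => e \o _) (naturality (adj_counit adj) h)) |].
  etransitivity; [symmetry; apply comp_assoc |].
  etransitivity;
    [exact (f_equal (comp h) (triangle_left adj W)) | apply comp_idr].
Qed.

(** * Trivial morphisms, kernels and cokernels *)

Section Triviality.
Variables (C : category) (Z : full_replete C).

Lemma trivial_comp_left (A B D : C) (g : B ~> D) (f : A ~> B) :
  is_trivial Z f -> is_trivial Z (g \o f).
Proof.
  intros (W & v & u & HW & ->).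
  exists W, (g \o v), u; split; [exact HW | apply comp_assoc].
Qed.

Lemma trivial_comp_right (A B D : C) (g : B ~> D) (f : A ~> B) :
  is_trivial Z g -> is_trivial Z (g \o f).
Proof.
  intros (W & v & u & HW & ->).
  exists W, v, (u \o f); split; [exact HW | symmetry; apply comp_assoc].
Qed.

Lemma trivial_dom (A B : C) (f : A ~> B) : Z A -> is_trivial Z f.
Proof.
  intros HA; exists A, f, (idm A); split; [exact HA | symmetry; apply comp_idr].
Qed.

Lemma trivial_cod (A B : C) (f : A ~> B) : Z B -> is_trivial Z f.
Proof.
  intros HB; exists B, (idm B), f; split; [exact HB | symmetry; apply comp_idl].
Qed.

Lemma kernel_mono (A B K : C) (f : A ~> B) (k : K ~> A) :
  is_kernel Z f k -> is_mono k.
Proof.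
  intros [Ht Hu] X x y E.
  destruct (Hu X (k \o x)) as (w & _ & Uw).
  { rewrite comp_assoc; now apply trivial_comp_right. }
  transitivity w; [symmetry; apply Uw; reflexivity | now apply Uw].
Qed.

Lemma cokernel_epi (A B Q : C) (f : A ~> B) (q : B ~> Q) :
  is_cokernel Z f q ->
  forall (X : C) (x y : Q ~> X), x \o q = y \o q -> x = y.
Proof.
  intros [Ht Hu] X x y E.
  destruct (Hu X (x \o q)) as (w & _ & Uw).
  { rewrite <- comp_assoc; now apply trivial_comp_left. }
  transitivity w; [symmetry; apply Uw; reflexivity | now apply Uw].
Qed.

(** If [f] is the kernel of [g] and [f \o x] factors through a morphism [v] from
    a trivial object, then [g \o v] is trivial, so [v] itself lifts through [f]. *)
Lemma normal_mono_reflects_trivial (A B X : C) (f : A ~> B) (x : X ~> A) :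
  normal_mono Z f -> is_trivial Z (f \o x) -> is_trivial Z x.
Proof.
  intros (D & g & Hk) (W & v & u & HW & E).
  destruct (proj2 Hk W v) as (v' & Hv & _).
  { now apply trivial_dom. }
  exists W, v', u; split; [exact HW |].
  apply (kernel_mono Hk).
  now rewrite E, Hv, comp_assoc.
Qed.

Lemma retractable_cokernel_isomorphic (A B Q : C) (f : A ~> B) (q : B ~> Q)
    (s : Q ~> B) :
  is_cokernel Z f q -> s \o q = idm B -> isomorphic Q B.
Proof.
  intros Hq Es; exists s, q; split; [| exact Es].
  apply (cokernel_epi Hq).
  now rewrite <- comp_assoc, Es, comp_idl, comp_idr.
Qed.

Lemma normal_epi_cokernel_of_kernel (K A B : C) (q : A ~> B) (k : K ~> A) :
  normal_epi Z q -> is_kernel Z q k -> is_cokernel Z k q.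
Proof.
  intros (D & g & [Hg Ug]) [Hk Uk]; split; [exact Hk |].
  intros X x Hx.
  (* [g] factors through the kernel of [q], so killing [k] entails killing [g]. *)
  destruct (Uk D g Hg) as (g' & Eg & _).
  apply Ug; rewrite Eg, comp_assoc; now apply trivial_comp_right.
Qed.

(** A normal monomorphism into [B] contains every trivial morphism into [B], so
    its inverse image along [g] contains the kernel of [g]. *)
Lemma kernel_lifts_to_pullback (K P X Y B : C)
    (p : P ~> X) (p' : P ~> Y) (f : X ~> B) (g : Y ~> B) (t : K ~> Y) :
  normal_mono Z f -> is_pullback p p' f g -> is_kernel Z g t ->
  exists t' : K ~> P, is_kernel Z p t'.
Proof.
  intros Hf [Esq Upb] Hk.
  assert (fmono : is_mono f) by (destruct Hf as (D & h & Hh); exact (kernel_mono Hh)).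
  pose proof (kernel_mono Hk) as tmono.
  destruct Hk as [Ht Uk].
  assert (Hx : exists x : K ~> X, g \o t = f \o x).
  { destruct Hf as (D & h & [_ Uh]).
    destruct (Uh K (g \o t)) as (x & Ex & _).
    - now apply trivial_comp_left.
    - now exists x. }
  destruct Hx as (x & Ex).
  destruct (Upb K x t (eq_sym Ex)) as (t' & [Ep Ep'] & _).
  exists t'; split.
  - rewrite Ep; apply (normal_mono_reflects_trivial Hf).
    now rewrite <- Ex.
  - intros U y Hy.
    destruct (Uk U (p' \o y)) as (y' & Ey & _).
    { rewrite comp_assoc, <- Esq, <- comp_assoc; now apply trivial_comp_left. }
    exists y'; split.
    + destruct (Upb U (p \o y) (p' \o y)) as (w & _ & Uw).
      { now rewrite !comp_assoc, Esq. }
      transitivity w; [symmetry |]; apply Uw; split; try reflexivity.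
      * apply fmono.
        rewrite (comp_assoc p), Ep, comp_assoc, <- Ex, <- comp_assoc, <- Ey.
        now rewrite !comp_assoc, Esq.
      * now rewrite comp_assoc, Ep'.
    + intros z Ez; apply tmono.
      now rewrite <- Ey, Ez, comp_assoc, Ep'.
Qed.

Lemma pullback_of_kernel (A B D M K : C) (h : B ~> D) (z : M ~> B) (g : A ~> B)
    (p : K ~> M) (k : K ~> A) :
  is_kernel Z h z -> is_pullback p k z g -> is_kernel Z (h \o g) k.
Proof.
  intros Hz [Esq Upb].
  pose proof (kernel_mono Hz) as zmono.
  destruct Hz as [Tz Uz]; split.
  - rewrite <- comp_assoc, <- Esq, comp_assoc; now apply trivial_comp_right.
  - intros X x Hx; rewrite <- comp_assoc in Hx.
    destruct (Uz X (g \o x) Hx) as (u & Eu & _).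
    destruct (Upb X u x (eq_sym Eu)) as (w & [Ep Ek] & Uw).
    exists w; split; [now symmetry |].
    intros w' Ew'; apply Uw; split; [| now symmetry].
    apply zmono.
    now rewrite comp_assoc, Esq, <- comp_assoc, <- Ew'.
Qed.

(** The kernel in question is the counit of the coreflection: that it is monic
    gives the uniqueness of factorizations, and that it is universal from trivial
    objects gives their existence for morphisms passing through such objects. *)
Lemma identity_kernel_of_mono_coreflective (B : C) :
  mono_coreflective Z ->
  exists (M : C) (z : M ~> B), Z M /\ is_kernel Z (idm B) z.
Proof.
  intros (R & adj & counit_mono).
  exists (inclusion Z (R B)), (adj_counit adj B).
  assert (RZ : Z (inclusion Z (R B))) by exact (proj2_sig (R B)).
  split; [exact RZ | split].
  - now apply trivial_dom.
  - intros X x Hx; rewrite comp_idl in Hx.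
    destruct Hx as (W & v & u & HW & ->).
    destruct (@adj_counit_factor _ _ _ _ adj (exist _ W HW : full_sub Z) B v)
      as (v' & Ev).
    exists ((v' : W ~> inclusion Z (R B)) \o u); split.
    + rewrite Ev; symmetry; apply comp_assoc.
    + intros y Ey; apply counit_mono.
      etransitivity; [| exact Ey].
      rewrite Ev; apply comp_assoc.
Qed.

(** * Normal-epi-reflective subcategories *)

Section Reflective.
Variables (F : full_replete C) (L : functor C (full_sub F)).
Variable adj : adjunction L (inclusion F).
Hypothesis unit_normal_epi : forall X : C, normal_epi Z (adj_unit adj X).

Lemma unit_factor (X B : C) (h : X ~> B) :
  F B -> exists h' : inclusion F (L X) ~> B, h = h' \o adj_unit adj X.
Proof.
  intros HB.
  destruct (@adj_unit_factor _ _ _ _ adj X (exist _ B HB : full_sub F) h)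
    as (h' & E).
  now exists h'.
Qed.

(** The unit at [X] is the cokernel of some [g].  Since [f] factors through this
    unit, [f \o g] is trivial, hence so is [g]; then [idm X] factors through the
    unit, which is therefore an epimorphism with a retraction. *)
Lemma normal_subobject_in_reflective (X B : C) (f : X ~> B) :
  normal_mono Z f -> F B -> F X.
Proof.
  intros Hf HB.
  destruct (unit_factor f HB) as (f' & Ef).
  destruct (unit_normal_epi X) as (D & g & Hg).
  assert (gtriv : is_trivial Z g).
  { apply (normal_mono_reflects_trivial Hf).
    rewrite Ef, <- comp_assoc; exact (trivial_comp_left f' (proj1 Hg)). }
  destruct (proj2 Hg X (idm X)) as (s & Es & _).
  { now apply trivial_comp_left. }
  apply (@replete _ F (inclusion F (L X))); [| exact (proj2_sig (L X))].
  exact (retractable_cokernel_isomorphic Hg (eq_sym Es)).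
Qed.

(** The torsion part of [Y] works: the unit kills it because its codomain is in
    [F], and anything killed by the unit is killed by the torsion-free quotient
    of [Y], which factors through the unit. *)
Lemma torsion_kernel_unit (T : full_replete C) (Y : C) :
  torsion_theory Z T F ->
  exists (K : C) (t : K ~> Y), T K /\ is_kernel Z (adj_unit adj Y) t.
Proof.
  intros [Hom Seq].
  destruct (Seq Y) as (K & B & t & g & HK & HB & [[_ Uk] _]).
  exists K, t; split; [exact HK | split].
  - apply Hom; [exact HK | exact (proj2_sig (L Y))].
  - intros X x Hx; apply Uk.
    destruct (unit_factor g HB) as (g' & ->).
    rewrite <- comp_assoc; now apply trivial_comp_left.
Qed.

End Reflective.

(** * The torsion class determined by a torsion-free class *)

Definition hom_trivial_to (F : full_replete C) (A : C) : Prop :=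
  forall (B : C) (h : A ~> B), F B -> is_trivial Z h.

Lemma hom_trivial_to_replete (F : full_replete C) (A B : C) :
  isomorphic A B -> hom_trivial_to F A -> hom_trivial_to F B.
Proof.
  intros (f & g & _ & Efg) HA D h HD.
  rewrite <- (comp_idr h), <- Efg, comp_assoc.
  now apply trivial_comp_right, HA.
Qed.

Definition left_class (F : full_replete C) : full_replete C :=
  FullReplete (@hom_trivial_to_replete F).

End Triviality.

(** * The characterization *)

Theorem proposition3p1 (C : category) (Z : full_replete C)
    (hC : semi_prenormal Z)
    (F : full_replete C)
    (L : functor C (full_sub F)) (adj : adjunction L (inclusion F))
    (hF : forall X : C, normal_epi Z (adj_unit adj X)) :
  torsion_free Z F <->
  (forall (P X Y : C) (p : P ~> X) (f' : P ~> Y) (f : X ~> inclusion F (L Y)),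
     normal_mono Z f ->
     is_pullback p f' f (adj_unit adj Y) ->
     is_reflection F p).
Proof.
  destruct hC as [Hcorefl Hpb _ Hstable].
  split.
  - intros (T & HT) P X Y p f' f Hf Hsq; split.
    + exact (normal_subobject_in_reflective hF Hf (proj2_sig (L Y))).
    + intros B h HB.
      destruct (torsion_kernel_unit adj Y HT) as (K & t & HK & Ht).
      destruct (kernel_lifts_to_pullback Hf Hsq Ht) as (t' & Ht').
      assert (Hp : normal_epi Z p) by exact (Hstable _ _ _ _ _ _ _ _ Hsq Hf (hF Y)).
      destruct (normal_epi_cokernel_of_kernel Hp Ht') as [_ Uc].
      apply Uc; now apply (torsion_hom_trivial HT).
  - intros Hrefl; exists (left_class Z F); split.
    + intros A B f HA HB; now apply HA.
    + intros X.
      destruct (identity_kernel_of_mono_coreflective (inclusion F (L X)) Hcorefl)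
        as (M & z & HM & Hker).
      assert (Hz : normal_mono Z z) by (now exists (inclusion F (L X)), (idm _)).
      destruct (Hpb _ _ _ z (adj_unit adj X) Hz) as (K & p & t & Hsq).
      pose proof (pullback_of_kernel Hker Hsq) as Ht; rewrite comp_idl in Ht.
      exists K, (inclusion F (L X)), t, (adj_unit adj X).
      split; [| split; [exact (proj2_sig (L X)) | split; [exact Ht |]]].
      * intros B h HB.
        destruct (Hrefl _ _ _ _ _ _ Hz Hsq) as [_ Ur].
        destruct (Ur B h HB) as (h' & -> & _).
        now apply trivial_comp_left, trivial_cod.
      * exact (normal_epi_cokernel_of_kernel (hF X) Ht).
Qed.
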